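(* Let $T$ be a Hausdorff space and let $\mu$ be a tight probability measure on it. Then there exists a Radon measure $\mu'$ on $T$ such that $\int_T f\, d\mu = \int_T f\, d\mu'$ for all bounded continuous functions $f \colon T \to \mathbb{R}$.
   Context: Measures are Borel probability measures. A Borel probability measure $\mu$ on a Hausdorff space $T$ is tight if for every real $\epsilon>0$ there is a compact $K_\epsilon\subseteq T$ with $\mu(K_\epsilon)>1-\epsilon$; it is Radon if $\mu(B)=\sup\{\mu(K):K\subseteq B,\ K\text{ compact}\}$ for every Borel set $B\subseteq T$. *)

(* Defs.v *)
From HB Require Import structures.
From mathcomp Require Import all_boot all_order all_algebra.
From mathcomp Require Import all_classical all_reals all_analysis.

Set Implicit Arguments.
Unset Strict Implicit.
Unset Printing Implicit Defensive.

Import Order.TTheory GRing.Theory Num.Theory.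
Import numFieldNormedType.Exports.

Local Open Scope classical_set_scope.
Local Open Scope ring_scope.

(* Measurable types are pointed in MathComp-Analysis, hence [ptopologicalType].
   This only excludes the empty space, which carries no probability measure. *)
Notation borelType T := (g_sigma_algebraType (@open T)).

(* The compact sets below are measurable when [T] is Hausdorff, being closed. *)
Definition tight (R : realType) (T : ptopologicalType)
    (mu : probability (borelType T) R) : Prop :=
  forall e : R, 0 < e ->
    exists2 K : set T, compact K & ((1 - e)%:E < mu K)%E.

Definition radon (R : realType) (T : ptopologicalType)
    (mu : probability (borelType T) R) : Prop :=
  forall B : set (borelType T), measurable B ->
    mu B = ereal_sup [set mu K | K in [set K : set T | K `<=` B /\ compact K]].

(* Main.v *)
Require Import Defs.
From HB Require Import structures.
From mathcomp Require Import all_boot all_order all_algebra.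
From mathcomp Require Import all_classical all_reals all_analysis.
From mathcomp Require Import lra.

(** The measure [mu] is replaced by one built from its values on open sets only.
For a compact set [K] let [c K] be the infimum of [mu U] over the open
neighbourhoods [U] of [K]. In a Hausdorff space two disjoint compact sets have
disjoint open neighbourhoods, and this makes [c] behave like a measure on
compact sets: it is monotone, subadditive, additive on disjoint compact sets
([outer_content_disjoint]) and satisfies [c K + c L <= 1 + c (K `&` L)]
([outer_content_setI]). The last inequality says that the deficit [1 - c K] is
subadditive under intersections, and compactness extends this to countable
intersections. Hence
<<
    om A = inf { 1 - c K | K compact, K disjoint from A }
>>
is an outer measure ([radon_outer_sigma_subadditive]), dual to the inner measure
sup { c K | K contained in A }.

Tightness provides compact sets with [c K] arbitrarily close to 1. It gives
[om set0 = 0], and it also gives Caratheodory's splitting condition for closed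
sets ([radon_outer_closed_split]): from a compact [K] disjoint from [A] and a
compact [L] almost of full mass one cuts [L] along the closed set [F] and adds
the two pieces to [K]. By Caratheodory's theorem [om] is a Borel probability
[P]. Passing to complements, [P B] is the supremum of the values [c K], over
the compact subsets [K] of [B], which is the Radon property because
[c K <= P K].

When [U] is open, [c K <= mu U] for every compact subset [K] of [U], so
[P U <= mu U]. The layer cake formula turns this into
[\int f dP <= \int f dmu] for every nonnegative continuous [f]. If [`|f| <= C],
this applies to both [C + f] and [C - f]; since both measures have total mass 1,
the two inequalities are opposite and the integrals of [f] agree. *)

Set Implicit Arguments.
Unset Strict Implicit.
Unset Printing Implicit Defensive.

Import Order.TTheory GRing.Theory Num.Theory.
Import numFieldNormedType.Exports.

Local Open Scope classical_set_scope.
Local Open Scope ring_scope.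

(** * Probabilities from outer measures *)

(** Caratheodory's theorem, stated on the sigma-algebra generated by [G] instead
of the one of all measurable sets for the outer measure. *)
Lemma caratheodory_generated_probability (R : realType) (T : pointedType)
    (G : set (set T)) (om : {outer_measure set T -> \bar R}) :
  G `<=` om.-caratheodory -> om setT = 1%E ->
  exists P : probability (g_sigma_algebraType G) R,
    forall A : set T, P A = om A.
Proof.
move=> Gom omT.
have sub : <<s G >> `<=` om.-caratheodory.
  apply: smallest_sub => //; split.
  - exact: caratheodory_measurable_set0.
  - by move=> A mA; rewrite setTD; exact: caratheodory_measurable_setC.
  - exact: caratheodory_measurable_bigcup.
pose P (A : set (g_sigma_algebraType G)) : \bar R := om A.
have P_sigma_additive : semi_sigma_additive P.
  move=> F mF tF mUF; apply: caratheodory_measure_sigma_additive => //.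
  - by move=> n; apply: sub; exact: mF.
  - exact: sub mUF.
pose mM := isMeasure.Build _ _ _ P (outer_measure0 om) (outer_measure_ge0 om)
  P_sigma_additive.
pose M : {measure set _ -> \bar R} := HB.pack P mM.
pose pM := Measure_isProbability.Build _ _ _ M omT.
by exists (HB.pack_for (probability (g_sigma_algebraType G) R) P mM pM).
Qed.

(** * Compact sets in Hausdorff spaces *)

(** A compact set that avoids all cluster points of a filter is separated from
it by one member of the filter. Taking the filter of neighbourhoods of a point,
and then that of a compact set, gives [compact_separation]. *)
Lemma compact_disjoint_cluster (T : topologicalType) (K : set T)
    (F : set_system T) :
  Filter F -> compact K -> K `&` cluster F = set0 ->
  exists2 W, F W & K `&` closure W = set0.
Proof.
move=> FF /compact_near_coveringP cK KF0.
have [F0|nF0] := pselect (F set0).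
  by exists set0; rewrite // closure0 setI0.
have PF : ProperFilter F by exact: Build_ProperFilter.
suff /near_powerset_filter_fromP[|V FV VK] :
    \forall W \near powerset_filter_from F, K `<=` ~` closure W.
- by move=> A B AB KB; apply: (subset_trans KB); exact/subsetC/closureS.
- by exists V => //; rewrite -subset0 => x [Kx]; exact: VK.
apply: cK => x Kx.
have [W FW nWx] : exists2 W, F W & ~ closure W x.
  apply: contrapT => nW; have : (K `&` cluster F) x.
    split=> //; rewrite clusterE => W FW; apply: contrapT => nWx.
    by apply: nW; exists W.
  by rewrite KF0.
exists (~` closure W, [set V | F V /\ V `<=` W]) => /=.
  split; last exact: powerset_filter_fromP.
  apply: open_nbhs_nbhs; split=> //.
  exact/closed_openC/closed_closure.
by move=> [y V] /= [nWy [FV VW]]; apply: contra_not nWy; exact: closureS.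
Qed.

Lemma compact_separation (T : topologicalType) (A B : set T) :
  hausdorff_space T -> compact A -> compact B -> A `&` B = set0 ->
  exists U V : set T,
    [/\ open U, open V, A `<=` U, B `<=` V & U `&` V = set0].
Proof.
move=> hT cA cB AB0.
have [|W BW AW] := @compact_disjoint_cluster T A (set_nbhs B) _ cA.
  rewrite -subset0 => x [Ax Bx].
  have [|U xU BU] := @compact_disjoint_cluster T B (nbhs x) _ cB.
    rewrite -subset0 => y [By /hT xy]; rewrite -AB0.
    by split=> //; rewrite -xy.
  have BnU : set_nbhs B (~` closure U).
    move=> y By; apply: open_nbhs_nbhs; split.
      exact/closed_openC/closed_closure.
    by move=> Uy; have : (B `&` closure U) y by []; rewrite BU.
  have [z [nUz Uz]] := Bx _ _ BnU xU.
  exact/nUz/subset_closure.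
exists (~` closure W), (interior W); split.
- exact/closed_openC/closed_closure.
- exact: open_interior.
- by move=> x Ax Wx; have : (A `&` closure W) x by []; rewrite AW.
- by move=> x Bx; exact: BW.
- rewrite -subset0 => x [nWx Wx].
  by apply: nWx; apply: subset_closure; exact: (@interior_subset _ W).
Qed.

(** The compact set [K 0 `\` U] is covered by the open complements of the [K n],
hence by finitely many of them. *)
Lemma compact_bigcap_subset (T : topologicalType) (K : nat -> set T)
    (U : set T) :
  hausdorff_space T -> (forall n, compact (K n)) -> open U ->
  \bigcap_n K n `<=` U ->
  exists n, \bigcap_(i in `I_n.+1) K i `<=` U.
Proof.
move=> hT cK oU KU.
have /compact_near_coveringP cKU : compact (K 0%N `\` U).
  by rewrite setDE; apply: compact_closedI => //; exact: open_closedC.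
have [|n _ nK] := cKU nat \oo (fun n x => ~ (\bigcap_(i in `I_n) K i) x) _.
  move=> x [_ nUx].
  have [n nKx] : exists n, ~ K n x.
    apply: contrapT => nK; apply/nUx/KU => n _; apply: contrapT => nKx.
    by apply: nK; exists n.
  exists (~` K n, [set k | (n < k)%N]) => /=.
    split; last by exists n.+1.
    apply: open_nbhs_nbhs; split=> //.
    by apply: closed_openC; exact: compact_closed.
  by move=> [y k] /= [nKy nk]; apply: contra_not nKy; exact.
exists n => x Kx; apply: contrapT => nUx.
by apply: (nK n.+1 (leqnSn n) x) => //; split=> //; exact: Kx.
Qed.

(** * The outer content of compact sets *)

Section outer_content.
Context (R : realType) (T : ptopologicalType).
Context (mu : probability (borelType T) R).

Lemma open_borel (U : set T) :
  open U -> measurable (U : set (borelType T)).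
Proof. by move=> oU; exact: sub_sigma_algebra. Qed.

Lemma closed_borel (F : set T) :
  closed F -> measurable (F : set (borelType T)).
Proof.
move=> cF; rewrite -[F]setCK; apply: measurableC.
by apply: open_borel; exact: closed_openC.
Qed.

Let m (U : set T) : R := fine (mu U).

Let mE (U : set T) : open U -> (m U)%:E = mu U.
Proof. by move=> oU; rewrite fineK// fin_num_measure//; exact: open_borel. Qed.

Let m_ge0 (U : set T) : 0 <= m U.
Proof. by apply: fine_ge0; exact: measure_ge0. Qed.

Let m_le1 (U : set T) : open U -> m U <= 1.
Proof.
by move=> oU; rewrite -lee_fin mE// probability_le1//; exact: open_borel.
Qed.

Let m_mono (U V : set T) : open U -> open V -> U `<=` V -> m U <= m V.
Proof.
move=> oU oV UV; rewrite -lee_fin !mE//.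
by apply: le_measure => //; rewrite inE; exact: open_borel.
Qed.

Let m_modular (U V : set T) : open U -> open V ->
  m (U `|` V) + m (U `&` V) = m U + m V.
Proof.
move=> oU oV; have oUV := openI oU oV.
apply: EFin_inj; rewrite !EFinD !mE//; last exact: openU.
rewrite measureUfinl ?subeK ?fin_num_measure ?ltey_eq ?fin_num_measure//;
  exact: open_borel.
Qed.

(** Real-valued, so that the estimates below are linear arithmetic over [R]; the
infimum is over a nonempty set, which contains [fine (mu setT)]. *)
Definition outer_content (K : set T) : R :=
  inf [set fine (mu U) | U in [set U : set T | open U /\ K `<=` U]].

Local Notation c := outer_content.

Lemma outer_content_le (K U : set T) :
  open U -> K `<=` U -> c K <= fine (mu U).
Proof.
move=> oU KU; apply: ge_inf; last by exists U.
by exists 0 => _ [V _ <-]; exact: m_ge0.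
Qed.

Lemma outer_content_adherent (K : set T) (e : R) : 0 < e ->
  exists U : set T, [/\ open U, K `<=` U & fine (mu U) < c K + e].
Proof.
move=> e0; have [|_ [U [oU KU] <-] Ue] := inf_adherent e0 (E :=
  [set fine (mu U) | U in [set U : set T | open U /\ K `<=` U]]).
  split; first by exists (m setT), setT => //; split; [exact: openT|].
  by exists 0 => _ [V _ <-]; exact: m_ge0.
by exists U.
Qed.

Lemma outer_content_ge (K : set T) (x : R) :
  (forall U : set T, open U -> K `<=` U -> x <= fine (mu U)) -> x <= c K.
Proof.
move=> xK; apply/ler_addgt0Pr => e e0.
have [U [oU KU Ue]] := outer_content_adherent K e0.
exact: le_trans (xK U oU KU) (ltW Ue).
Qed.

Lemma outer_content_ge0 (K : set T) : 0 <= c K.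
Proof. by apply: outer_content_ge => U _ _; exact: m_ge0. Qed.

Lemma outer_content_le1 (K : set T) : c K <= 1.
Proof.
by apply: le_trans (m_le1 openT); apply: outer_content_le; [exact: openT|].
Qed.

Lemma outer_content0 : c set0 = 0.
Proof.
apply/eqP; rewrite eq_le outer_content_ge0 andbT.
apply: le_trans (_ : m set0 <= 0); last by rewrite /m measure0.
by apply: outer_content_le; [exact: open0|].
Qed.

Lemma outer_content_mono (K L : set T) : K `<=` L -> c K <= c L.
Proof.
move=> KL; apply: outer_content_ge => U oU LU; apply: outer_content_le => //.
exact: subset_trans LU.
Qed.

Lemma measure_le_outer_content (K : set T) :
  closed K -> (mu K <= (c K)%:E)%E.
Proof.
move=> cK; have mK := closed_borel cK.
rewrite -[mu K]fineK ?fin_num_measure// lee_fin.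
apply: outer_content_ge => U oU KU.
rewrite fine_le ?fin_num_measure//; first exact: open_borel.
by apply: le_measure; rewrite ?inE//; exact: open_borel.
Qed.

Lemma outer_content_setU (K L : set T) : c (K `|` L) <= c K + c L.
Proof.
apply/ler_addgt0Pr => e e0; have e20 : 0 < e / 2 by rewrite divr_gt0.
have [U [oU KU Ue]] := outer_content_adherent K e20.
have [V [oV LV Ve]] := outer_content_adherent L e20.
have := outer_content_le (openU oU oV) (setUSS KU LV).
have := m_modular oU oV; have := m_ge0 (U `&` V).
rewrite /m; lra.
Qed.

Context (hT : hausdorff_space T).

(** Inside a neighbourhood [W] of [K `|` L], disjoint neighbourhoods of [K] and
[L] have total mass at most that of [W]. *)
Lemma outer_content_disjoint (K L : set T) :
  compact K -> compact L -> K `&` L = set0 -> c K + c L <= c (K `|` L).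
Proof.
move=> cK cL KL0; apply: outer_content_ge => W oW KLW.
have [U [V [oU oV KU LV UV0]]] := compact_separation hT cK cL KL0.
have oUW := openI oU oW; have oVW := openI oV oW.
have KUW : c K <= m (U `&` W).
  by apply: outer_content_le => // x Kx; split; [exact: KU | apply: KLW; left].
have LVW : c L <= m (V `&` W).
  by apply: outer_content_le => // x Lx; split; [exact: LV | apply: KLW; right].
apply: le_trans (lerD KUW LVW) _; rewrite -m_modular//.
rewrite setIACA UV0 set0I [m set0]/m measure0 addr0.
by apply: m_mono => //; [exact: openU | move=> x [[]|[]]].
Qed.

(** Let [W] be a neighbourhood of [K `&` L] of almost minimal mass. The compact
sets [K `\` W] and [L `\` W] are disjoint, so they have disjoint neighbourhoods
[U] and [V]. Then [U `|` W] and [V `|` W] are neighbourhoods of [K] and [L] that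
intersect exactly in [W], and the mass of their union is at most 1. *)
Lemma outer_content_setI (K L : set T) :
  compact K -> compact L -> c K + c L <= 1 + c (K `&` L).
Proof.
move=> cK cL; apply/ler_addgt0Pr => e e0.
have [W [oW KLW We]] := outer_content_adherent (K `&` L) e0.
have cKW : compact (K `\` W).
  by rewrite setDE; apply: compact_closedI => //; exact: open_closedC.
have cLW : compact (L `\` W).
  by rewrite setDE; apply: compact_closedI => //; exact: open_closedC.
have KLW0 : (K `\` W) `&` (L `\` W) = set0.
  by rewrite -subset0 => x [[Kx nWx] [Lx _]]; apply: nWx; exact: KLW.
have [U [V [oU oV KU LV UV0]]] := compact_separation hT cKW cLW KLW0.
have oUW := openU oU oW; have oVW := openU oV oW.
have KUW : c K <= m (U `|` W).
  apply: outer_content_le => // x Kx.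
  by have [Wx|nWx] := pselect (W x); [right | left; exact: KU].
have LVW : c L <= m (V `|` W).
  apply: outer_content_le => // x Lx.
  by have [Wx|nWx] := pselect (W x); [right | left; exact: LV].
have := m_modular oUW oVW; rewrite -setUIl UV0 set0U.
have := m_le1 (openU oUW oVW).
move: We; rewrite -/(m W); lra.
Qed.

Lemma compact_bigsetI (K : nat -> set T) n :
  (forall k, compact (K k)) -> compact (\big[setI/setT]_(i < n.+1) K i).
Proof.
move=> cK; elim: n => [|n IHn]; first by rewrite big_ord1.
rewrite big_ord_recr/=; apply: compact_closedI => //.
exact: compact_closed.
Qed.

Lemma outer_content_bigsetI (K : nat -> set T) n :
  (forall k, compact (K k)) ->
  1 - c (\big[setI/setT]_(i < n.+1) K i) <= \sum_(i < n.+1) (1 - c (K i)).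
Proof.
move=> cK; elim: n => [|n IHn]; first by rewrite !big_ord1.
rewrite big_ord_recr [leRHS]big_ord_recr/=.
have := outer_content_setI (compact_bigsetI (n := n) cK) (cK n.+1).
lra.
Qed.

(** * The outer measure dual to the content *)

(** One minus the inner measure sup { c K | K `<=` ~` A } of the complement. *)
Definition radon_outer_measure (A : set T) : \bar R :=
  ereal_inf [set (1 - c K)%:E |
    K in [set K : set T | compact K /\ K `&` A = set0]].

Local Notation om := radon_outer_measure.

Lemma radon_outer_le (K A : set T) :
  compact K -> K `&` A = set0 -> (om A <= (1 - c K)%:E)%E.
Proof. by move=> cK KA; apply: ereal_inf_lbound; exists K. Qed.

Lemma radon_outer_ge (A : set T) (x : \bar R) :
  (forall K, compact K -> K `&` A = set0 -> x <= (1 - c K)%:E)%E ->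
  (x <= om A)%E.
Proof.
by move=> xA; apply: le_ereal_inf_tmp => _ [K [cK KA] <-]; exact: xA.
Qed.

Lemma radon_outer_ge0 (A : set T) : (0 <= om A)%E.
Proof.
by apply: radon_outer_ge => K _ _; rewrite lee_fin subr_ge0 outer_content_le1.
Qed.

Lemma radon_outer_le1 (A : set T) : (om A <= 1)%E.
Proof.
have := @radon_outer_le set0 A (@compact0 _) (set0I A).
by rewrite outer_content0 subr0.
Qed.

Lemma radon_outer_fin_num (A : set T) : om A \is a fin_num.
Proof.
rewrite ge0_fin_numE ?radon_outer_ge0//.
by rewrite (le_lt_trans (radon_outer_le1 A))// ltry.
Qed.

Lemma radon_outer_adherent (A : set T) (e : R) : 0 < e ->
  exists K : set T,
    [/\ compact K, K `&` A = set0 & ((1 - c K)%:E < om A + e%:E)%E].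
Proof.
move=> e0.
have [_ [K [cK KA] <-] Ke] := lb_ereal_inf_adherent e0 (radon_outer_fin_num A).
by exists K.
Qed.

Lemma radon_outer_mono : {homo om : A B / A `<=` B >-> (A <= B)%E}.
Proof.
move=> A B AB; apply: radon_outer_ge => K cK KB; apply: radon_outer_le => //.
by rewrite -subset0 => x [Kx /AB Bx]; rewrite -KB.
Qed.

Lemma radon_outer_setT : om setT = 1%E.
Proof.
apply/eqP; rewrite eq_le radon_outer_le1/=; apply: radon_outer_ge => K _.
by rewrite setIT => ->; rewrite outer_content0 subr0.
Qed.

(** If [K n] is disjoint from [F n], then the intersection of the [K n] is
disjoint from the union of the [F n]. Any neighbourhood [U] of that intersection
contains a finite intersection of the [K n], whose deficit is at most the sum of
their deficits. *)
Lemma radon_outer_sigma_subadditive : sigma_subadditive om.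
Proof.
move=> F; apply/lee_addgt0Pr => e e0.
have /choice[K KP] : forall n, exists K : set T, [/\ compact K,
    K `&` F n = set0 & ((1 - c K)%:E < om (F n) + (e / (2 ^ n.+1)%:R)%:E)%E].
  by move=> n; apply: radon_outer_adherent; rewrite divr_gt0// ltr0n expn_gt0.
have cK n : compact (K n) by have [] := KP n.
have Kge0 n : (0 <= (1 - c (K n))%:E)%E.
  by rewrite lee_fin subr_ge0 outer_content_le1.
have om_ge0 n : (0 <= om (F n))%E by exact: radon_outer_ge0.
apply: le_trans (epsilon_trick xpredT om_ge0 (ltW e0)).
apply: (@le_trans _ _ (\sum_(n <oo) (1 - c (K n))%:E)%E); last first.
  by apply: lee_nneseries => // n _; apply: ltW; have [] := KP n.
have cIK : compact (\bigcap_n K n).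
  rewrite (_ : \bigcap_n K n = K 0%N `&` \bigcap_n K n).
    apply: compact_closedI => //; apply: closed_bigI => n _.
    exact: compact_closed.
  by rewrite setIidr// => x; exact.
apply: le_trans (radon_outer_le cIK _) _.
  rewrite -subset0 => x [Kx [n _ Fx]].
  by have [_ <- _] := KP n; split=> //; exact: Kx.
apply/lee_addgt0Pr => d d0.
have [U [oU KU Ud]] := outer_content_adherent (\bigcap_n K n) d0.
have [n] := compact_bigcap_subset hT cK oU KU.
rewrite bigcap_mkord => /(outer_content_le oU) KnU.
apply: (@le_trans _ _ ((\sum_(i < n.+1) (1 - c (K i)))%:E + d%:E)%E).
  rewrite -EFinD lee_fin.
  have := outer_content_bigsetI n cK; lra.
rewrite leeD2r// -sumEFin -(big_mkord xpredT (fun i => (1 - c (K i))%:E)).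
exact: nneseries_lim_ge.
Qed.

(** * Caratheodory measurability of closed sets *)

Context (hmu : tight mu).

Lemma radon_outer_set0 : om set0 = 0%E.
Proof.
apply/eqP; rewrite eq_le radon_outer_ge0 andbT; apply/lee_addgt0Pr => e e0.
have [K cK Ke] := hmu e0.
apply: le_trans (radon_outer_le cK (setI0 K)) _.
have := lt_le_trans Ke (measure_le_outer_content (compact_closed hT cK)).
rewrite add0e lte_fin lee_fin; lra.
Qed.

(** Given [K] compact and disjoint from [A], and [L] compact with mass almost 1,
the set [K `|` (L `&` F)] is disjoint from [A `\` F]. Removing from [L] a
neighbourhood [U] of that set, of almost minimal mass, leaves a compact set
disjoint from [K] and from [F], whose union with [K] is disjoint from [A `&` F].
Up to a small error, the contents of [K `|` (L `&` F)] and [K `|` (L `\` U)] add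
up to at least [c K + c L], so that their deficits add up to at most
[1 - c K]. *)
Lemma radon_outer_closed_split (F A : set T) :
  closed F -> (om (A `&` F) + om (A `&` ~` F) <= om A)%E.
Proof.
move=> cF; apply/lee_addgt0Pr => e e0.
have e30 : 0 < e / 3 by rewrite divr_gt0.
have [K [cK KA Ke]] := radon_outer_adherent A e30.
have [L cL Le] := hmu e30.
have {}Le := lt_le_trans Le (measure_le_outer_content (compact_closed hT cL)).
have cKLF : compact (K `|` (L `&` F)).
  by apply: compactU => //; exact: compact_closedI.
have [U [oU KLU Ue]] := outer_content_adherent (K `|` (L `&` F)) e30.
have cLU : compact (L `\` U).
  by rewrite setDE; apply: compact_closedI => //; exact: open_closedC.
have KLU0 : K `&` (L `\` U) = set0.
  by rewrite -subset0 => x [Kx [_]]; apply; apply: KLU; left.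
have := radon_outer_le cKLF (A := A `&` ~` F).
have := radon_outer_le (compactU cK cLU) (A := A `&` F).
move=> /(_ _)/leeD H /(_ _)/H{}H.
apply: le_trans (H _ _) _.
- rewrite -subset0 => x [[Kx|[Lx nUx]] [Ax Fx]].
    by rewrite -KA.
  by apply: nUx; apply: KLU; right.
- rewrite -subset0 => x [[Kx|[Lx Fx]] [Ax nFx]] //.
  by rewrite -KA.
have LU : c L <= c (L `\` U) + fine (mu U).
  apply: le_trans (_ : c ((L `\` U) `|` U) <= _).
    apply: outer_content_mono => x Lx.
    by have [Ux|nUx] := pselect (U x); [right|left].
  apply: le_trans (outer_content_setU _ _) _.
  by rewrite lerD2l; exact: outer_content_le.
have := outer_content_disjoint cK cLU KLU0.
move: (fineK (radon_outer_fin_num A)) Ke Le => <-.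
rewrite -!EFinD !lte_fin lee_fin; lra.
Qed.

(** * The Radon probability dominated by the given one on open sets *)

(** A compact set [L] disjoint from [K] satisfies
[c L + c K <= c (L `|` K) <= 1]. *)
Lemma outer_content_le_radon_outer (K : set T) :
  compact K -> ((c K)%:E <= om K)%E.
Proof.
move=> cK; apply: radon_outer_ge => L cL LK.
have := outer_content_disjoint cL cK LK.
have := outer_content_le1 (L `|` K).
rewrite lee_fin; lra.
Qed.

(** The measure is [om]. Both the Radon property and the comparison with [mu]
are read off the complement: [P B = 1 - om (~` B)] is approximated by the values
[c K], over the compact subsets [K] of [B]. *)
Lemma radon_le_on_open : exists2 P : probability (borelType T) R,
  radon P & forall U : set T, open U -> (P U <= mu U)%E.
Proof.
pose mO := isOuterMeasure.Build R T om radon_outer_set0 radon_outer_ge0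
  radon_outer_mono radon_outer_sigma_subadditive.
pose O : {outer_measure set T -> \bar R} := HB.pack om mO.
have openO : @open T `<=` O.-caratheodory.
  move=> U oU; rewrite -[U]setCK; apply: caratheodory_measurable_setC.
  apply: le_caratheodory_measurable => A; apply: radon_outer_closed_split.
  exact: open_closedC.
have [P PE] := caratheodory_generated_probability openO radon_outer_setT.
have Pcompl (B : set (borelType T)) : measurable B -> P B = (1 - om (~` B))%E.
  move=> mB; rewrite -[B in LHS]setCK probability_setC ?PE//.
  exact: measurableC.
exists P => [B mB|U oU].
- apply/eqP; rewrite eq_le; apply/andP; split; last first.
    apply: ge_ereal_sup => _ [K [KB cK] <-].
    by rewrite !PE; exact: radon_outer_mono.
  apply/lee_addgt0Pr => e e0.
  have [K [cK KB0 Ke]] := radon_outer_adherent (~` B) e0.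
  have KB : K `<=` B by apply/subsets_disjoint; rewrite KB0.
  have : (P K <= ereal_sup [set P K | K in
      [set K : set T | K `<=` B /\ compact K]])%E.
    by apply: ereal_sup_ubound; exists K.
  move=> /(leeD2r e%:E); apply: le_trans.
  apply: (@le_trans _ _ ((c K)%:E + e%:E)%E); last first.
    by rewrite leeD2r// PE; exact: outer_content_le_radon_outer.
  move: Ke; rewrite Pcompl// -(fineK (radon_outer_fin_num (~` B))).
  rewrite -!EFinD lte_fin lee_fin; lra.
- rewrite Pcompl; last exact: open_borel.
  have mUfin : mu U \is a fin_num.
    by rewrite fin_num_measure//; exact: open_borel.
  have : (1 - mu U <= om (~` U))%E.
    apply: radon_outer_ge => K cK /subsets_disjoint KU.
    rewrite -(fineK mUfin) -EFinN -EFinD lee_fin lerB//.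
    exact: outer_content_le.
  rewrite -(fineK mUfin) -(fineK (radon_outer_fin_num (~` U))).
  rewrite -!EFinN -!EFinD !lee_fin; lra.
Qed.

End outer_content.

(** * Comparison of integrals *)

Lemma continuous_borel_measurable (R : realType) (T : ptopologicalType)
    (f : T -> R) :
  continuous f -> measurable_fun [set: borelType T] f.
Proof.
move=> /continuousP cf.
apply: (measurability _ (measurable_realfun.RGenOpens.measurableE R)).
move=> _ [_ [a [b ->] <-]]; rewrite setTI.
by apply: open_borel; apply: cf; exact: interval_open.
Qed.

(** Layer cake: the integral of a nonnegative [f] is the integral over [r >= 0]
of the mass of the set [f > r], which is open. *)
Lemma ge0_integral_le_on_open (R : realType) (T : ptopologicalType)
    (P Q : probability (borelType T) R) (f : T -> R) :
  (forall U : set T, open U -> (P U <= Q U)%E) ->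
  continuous f -> (forall x, 0 <= f x) ->
  (\int[P]_(x in [set: borelType T]) (f x)%:E <=
   \int[Q]_(x in [set: borelType T]) (f x)%:E)%E.
Proof.
move=> PQ cf f0.
pose mf := isMeasurableFun.Build _ _ _ _ _ (continuous_borel_measurable cf).
pose X : {mfun borelType T >-> R} := HB.pack f mf.
have := @ge0_expectation_ccdf _ _ R P X f0.
have := @ge0_expectation_ccdf _ _ R Q X f0.
rewrite !expectation_def => -> ->.
apply: ge0_le_integral => //.
(* [ccdf_measurable] and [lebesgue_measure] put different displays on [R], so
   measurability is transferred on preimages. *)
- move=> mD Y mY; apply: measurableI => //.
  have mS := @ccdf_measurable _ _ R P X.
  by have := mS measurableT Y mY; rewrite setTI; exact.
- move=> mD Y mY; apply: measurableI => //.
  have mS := @ccdf_measurable _ _ R Q X.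
  by have := mS measurableT Y mY; rewrite setTI; exact.
- move=> r _; apply: PQ; have /continuousP := cf; apply.
  exact: interval_open.
Qed.

(** For [`|f| <= C] the comparison of integrals applies to the nonnegative
functions [f + C] and [C - f], and yields the two inequalities for [f]. *)
Lemma integral_eq_le_on_open (R : realType) (T : ptopologicalType)
    (P Q : probability (borelType T) R) (f : T -> R) :
  (forall U : set T, open U -> (P U <= Q U)%E) ->
  continuous f -> bounded_fun f ->
  (\int[P]_(x in [set: borelType T]) (f x)%:E =
   \int[Q]_(x in [set: borelType T]) (f x)%:E)%E.
Proof.
move=> PQ cf bf; have mf := continuous_borel_measurable cf.
have [C fC] : exists C, forall x, `|f x| <= C.
  have [M [_ HM]] := bf; exists (M + 1) => x.
  by apply: HM => //; rewrite ltrDl.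
have intf (S : probability (borelType T) R) :
    S.-integrable [set: borelType T] (EFin \o f).
  apply: measurable_bounded_integrable => //.
  by rewrite [X in (X < _)%E]probability_setT ltry.
have intC (S : probability (borelType T) R) :
    S.-integrable [set: borelType T] (EFin \o cst C).
  exact: finite_measure_integrable_cst.
have intS (S : probability (borelType T) R) :
    (\int[S]_(x in [set: borelType T]) C%:E = C%:E)%E.
  by rewrite integral_cst// [X in (_ * X)%E]probability_setT mule1.
have fin (S : probability (borelType T) R) :
    (\int[S]_(x in [set: borelType T]) (f x)%:E)%E \is a fin_num.
  by apply: integrable_fin_num => //; exact: intf.
have addC (S : probability (borelType T) R) :
    (\int[S]_(x in [set: borelType T]) (f x + C)%:E =
     \int[S]_(x in [set: borelType T]) (f x)%:E + C%:E)%E.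
  by rewrite -(intS S) -integralD_EFin//; [exact: intf | exact: intC].
have subC (S : probability (borelType T) R) :
    (\int[S]_(x in [set: borelType T]) (C - f x)%:E =
     C%:E - \int[S]_(x in [set: borelType T]) (f x)%:E)%E.
  by rewrite -(intS S) -integralB_EFin//; [exact: intC | exact: intf].
have fC_ge0 x : 0 <= f x + C.
  by have := fC x; rewrite ler_norml => /andP[]; lra.
have Cf_ge0 x : 0 <= C - f x.
  by have := fC x; rewrite ler_norml => /andP[]; lra.
have cfC : continuous (fun x => f x + C).
  by move=> x; apply: cvgD; [exact: cf | exact: cvg_cst].
have cCf : continuous (fun x => C - f x).
  by move=> x; apply: cvgB; [exact: cvg_cst | exact: cf].
apply/eqP; rewrite eq_le; apply/andP; split.
  have := ge0_integral_le_on_open PQ cfC fC_ge0.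
  by rewrite !addC leeD2rE.
have := ge0_integral_le_on_open PQ cCf Cf_ge0.
by rewrite !subC leeD2lE// leeN2.
Qed.

Theorem corollaryB26 (R : realType) (T : ptopologicalType)
    (hT : hausdorff_space T)
    (mu : probability (borelType T) R) (hmu : tight mu) :
  exists2 mu' : probability (borelType T) R, radon mu' &
    forall f : T -> R, continuous f -> bounded_fun f ->
      (\int[mu]_(x in [set: borelType T]) (f x)%:E =
       \int[mu']_(x in [set: borelType T]) (f x)%:E)%E.
Proof.
have [P radonP Pmu] := radon_le_on_open hT hmu.
by exists P => // f cf bf; rewrite -(integral_eq_le_on_open Pmu cf bf).
Qed.
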